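(* For every integer $r\ge 2$, the H-graph $H(r)$ satisfies $\chi_\rho(H(r))=5$ if $r$ is even, and $6\le \chi_\rho(H(r))\le 7$ if $r$ is odd.
   Context: All graphs are simple; $d_G(u,v)$ is the shortest-path distance. A packing $k$-colouring of $G$ is a map $\pi:V(G)\to\{1,\dots,k\}$ such that for distinct $u,v$, $\pi(u)=\pi(v)=i$ implies $d_G(u,v)>i$; $\chi_\rho(G)$ is the least $k$ for which a packing $k$-colouring exists. For $r\ge 2$, the H-graph $H(r)$ has vertex set $\{u_i,v_i,w_i: 0\le i\le 2r-1\}$ and edge set $\{u_iu_{i+1},\ w_iw_{i+1},\ u_iv_i,\ v_iw_i : 0\le i\le 2r-1\}\cup\{v_{2i}v_{2i+1}: 0\le i\le r-1\}$ (subscripts modulo $2r$); it is a 3-regular graph of order $6r$. *)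

(* Defs.v *)
From HB Require Import structures.
From mathcomp Require Import all_boot.

Set Implicit Arguments.
Unset Strict Implicit.
Unset Printing Implicit Defensive.

Record sgraph := SGraph {
  vertex :> finType;
  adj : rel vertex;
  adj_sym : symmetric adj;
  adj_irrefl : irreflexive adj }.

Section Distance.
Variable G : sgraph.
Implicit Types u v : G.

Definition walk_of_length u v (n : nat) : bool :=
  [exists p : n.-tuple G, path (@adj G) u p && (last u p == v)].

Lemma connect_walk u v :
  connect (@adj G) u v -> exists n, walk_of_length u v n.
Proof.
case/connectP=> p pp ->; exists (size p).
by apply/existsP; exists (in_tuple p); rewrite /= pp eqxx.
Qed.

(* [None] is an infinite distance, between distinct connected components. *)
Definition dist u v : option nat :=
  match @idP (connect (@adj G) u v) with
  | ReflectT uv => Some (ex_minn (connect_walk uv))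
  | ReflectF _ => None
  end.

Definition dist_gt u v (i : nat) : bool :=
  if dist u v is Some d then i < d else true.

End Distance.

Definition packing_colouring (G : sgraph) (k : nat) (pi : G -> nat) : bool :=
  [forall u, 1 <= pi u <= k] &&
  [forall u, forall v, (u != v) && (pi u == pi v) ==> dist_gt u v (pi u)].

(* Restricting to maps into ['I_k.+1] loses nothing: a packing k-colouring takes its
   values in [1, ..., k], so the value 0 is never used. *)
Definition packing_colourable (G : sgraph) (k : nat) : bool :=
  [exists pi : {ffun G -> 'I_k.+1}, packing_colouring k (fun u : G => pi u)].

Lemma packing_colourable_exists (G : sgraph) :
  exists k, packing_colourable G k.
Proof.
exists #|G|; apply/existsP; exists [ffun u : G => lift ord0 (enum_rank u)].
apply/andP; split; first by apply/forallP=> u; rewrite ffunE lift0 /= ltn_ord.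
apply/forallP=> u; apply/forallP=> v; rewrite !ffunE !lift0 eqSS.
apply/implyP=> /andP[/eqP uv /eqP e].
by case: uv; apply: enum_rank_inj; apply: val_inj.
Qed.

Definition packing_chromatic_number (G : sgraph) : nat :=
  ex_minn (packing_colourable_exists G).

Inductive hvertex (n : nat) : predArgType :=
  | hU of 'I_n
  | hV of 'I_n
  | hW of 'I_n.

Definition hvertex_code n (x : hvertex n) : 'I_n + 'I_n + 'I_n :=
  match x with hU i => inl (inl i) | hV i => inl (inr i) | hW i => inr i end.

Definition hvertex_decode n (x : 'I_n + 'I_n + 'I_n) : hvertex n :=
  match x with inl (inl i) => hU i | inl (inr i) => hV i | inr i => hW i end.

Lemma hvertex_codeK n : cancel (@hvertex_code n) (@hvertex_decode n).
Proof. by case. Qed.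

HB.instance Definition _ n :=
  Finite.copy (hvertex n) (can_type (@hvertex_codeK n)).

(* Each edge is listed in one direction; [ordS i] is [i + 1] modulo [2 * r]. *)
Definition harc r (x y : hvertex (2 * r)) : bool :=
  match x, y with
  | hU i, hU j => j == ordS i
  | hW i, hW j => j == ordS i
  | hU i, hV j => i == j
  | hV i, hW j => i == j
  | hV i, hV j =>
      [exists k : 'I_r, (i == 2 * k :> nat) && (j == (2 * k).+1 :> nat)]
  | _, _ => false
  end.

Definition hadj r : rel (hvertex (2 * r)) :=
  fun x y => harc x y || harc y x.

Lemma hadj_sym r : symmetric (@hadj r).
Proof. by move=> x y; rewrite /hadj orbC. Qed.

Lemma ordS_neq r (i : 'I_(2 * r)) : (i == ordS i) = false.
Proof.
apply/negbTE/eqP=> /(congr1 val) /=; have := ltn_ord i.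
rewrite leq_eqVlt => /orP[/eqP e|lt].
  rewrite e modnn => i0; move: e; rewrite i0.
  by case: r {i i0} => [|r] //; rewrite mulnS.
by rewrite modn_small // => /eqP; rewrite eqn_leq ltnn andbF.
Qed.

Lemma hadj_irrefl r : irreflexive (@hadj r).
Proof.
case=> i; rewrite /hadj /= orbb ?ordS_neq //.
by apply/existsP=> -[k /andP[/eqP ->]]; rewrite eqn_leq ltnn andbF.
Qed.

Definition H_graph (r : nat) : sgraph :=
  SGraph (@hadj_sym r) (@hadj_irrefl r).

(* Main.v *)
(* H(r) is the quotient of an infinite strip, whose vertices are numbered by nat
   (the vertex of row e in column c is 3c+e, rows u, v, w), by translation by 6r.

   Lower bounds: an exhaustive search shows that no four consecutive columns of the
   strip have a packing 4-colouring, and that in a packing 5-colouring of six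
   consecutive columns, starting at an even one, colour 5 occurs in exactly one of the
   first two column pairs.  So colour 5 alternates along the cyclic sequence of r
   column pairs, which forces r to be even.

   Upper bounds: for even r repeat the four columns (1,4,1) (2,1,3) (1,5,1) (3,1,2);
   for odd r replace the first three columns by (6,1,2) (1,4,1) (2,5,7), where 6 and 7
   occur only once.  Colours up to 5 only see 15 vertices on each side, so up to
   translation there are finitely many windows to check. *)
Require Import Defs.
From mathcomp Require Import all_boot zify.

Set Implicit Arguments.
Unset Strict Implicit.
Unset Printing Implicit Defensive.

(** * Distance in terms of walks *)

Lemma dist_gtP (G : sgraph) (u v : G) i :
  reflect (forall n, n <= i -> ~~ walk_of_length u v n) (dist_gt u v i).
Proof.
rewrite /dist_gt /dist; case: {-}_ / idP => [uv|nuv].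
  case: ex_minnP => d wd dmin; apply: (iffP idP) => [lt_id n le_ni | no_walk].
    by apply/negP=> /dmin; rewrite leqNgt (leq_ltn_trans le_ni lt_id).
  by rewrite ltnNge; apply/negP=> /no_walk; rewrite wd.
constructor=> n _; apply/existsP=> -[p /andP[pp /eqP lp]].
by case: nuv; apply/connectP; exists p.
Qed.

Lemma walk0 (G : sgraph) (u v : G) : walk_of_length u v 0 = (u == v).
Proof.
apply/existsP/idP => [[p]|/eqP->]; first by rewrite (tuple0 p).
by exists [tuple]; rewrite /= eqxx.
Qed.

Lemma walkS (G : sgraph) (u v : G) n :
  reflect (exists2 w, walk_of_length u w n & adj w v) (walk_of_length u v n.+1).
Proof.
apply: (iffP existsP) => [[[p /= sp] /=]|[w /existsP[p]]].
  elim/last_ind: p sp => // p w _; rewrite size_rcons eqSS => sp.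
  rewrite rcons_path last_rcons => /andP[/andP[pp pw] /eqP <-].
  exists (last u p) => //; apply/existsP; exists (Tuple sp).
  by rewrite /= pp eqxx.
case/andP=> pp /eqP lp wv; exists [tuple of rcons p v].
by rewrite /= rcons_path pp last_rcons lp wv eqxx.
Qed.

(** * Balls in the strip and their translations *)

(* The v-rows of a column pair are 1 and 4 modulo 6, and the edge between them is the
   only horizontal edge at either.  Truncated subtraction makes this wrong for i < 3,
   whence the lower bounds on positions throughout. *)
Definition snbr (i : nat) : seq nat :=
  [seq i + 3 | _ <- nseq (i %% 6 != 4) tt] ++
  [seq i + 1 | _ <- nseq (i %% 3 != 2) tt] ++
  [seq i - 3 | _ <- nseq (i %% 6 != 1) tt] ++
  [seq i - 1 | _ <- nseq (i %% 3 != 0) tt].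

Lemma mem_snbr i j :
  (j \in snbr i) =
  [|| (i %% 6 != 4) && (j == i + 3), (i %% 3 != 2) && (j == i + 1),
      (i %% 6 != 1) && (j == i - 3) | (i %% 3 != 0) && (j == i - 1)].
Proof.
rewrite /snbr !mem_cat.
by do !congr (_ || _); case: (_ != _); rewrite //= inE.
Qed.

Fixpoint near (n i : nat) : seq nat :=
  if n is m.+1 then undup (near m i ++ flatten (map snbr (near m i))) else [:: i].

Lemma nearS n i j :
  reflect (j \in near n i \/ exists2 k, k \in near n i & j \in snbr k)
    (j \in near n.+1 i).
Proof.
rewrite /= mem_undup mem_cat; apply: (iffP orP) => -[H|H]; try by left.
  by right; have /flatten_mapP := H.
by right; apply/flatten_mapP.
Qed.

Lemma snbr_bounds i j : j \in snbr i -> i <= j + 3 /\ j <= i + 3.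
Proof.
by rewrite mem_snbr => /or4P[] /andP[_ /eqP->]; split; lia.
Qed.

Lemma near_bounds n i j : j \in near n i -> i <= j + 3 * n /\ j <= i + 3 * n.
Proof.
elim: n j => [|n IHn] j; first by rewrite inE => /eqP->; lia.
case/nearS=> [/IHn|[k /IHn kb /snbr_bounds]]; lia.
Qed.

Lemma modnD6 i s : (i + 6 * s) %% 6 = i %% 6.
Proof. by rewrite addnC mulnC modnMDl. Qed.

Lemma modnD3 i s : (i + 6 * s) %% 3 = i %% 3.
Proof. by rewrite addnC -(mulnA 3 2) mulnC modnMDl. Qed.

Lemma mem_snbr_shift i j s : 3 <= i ->
  (j + 6 * s \in snbr (i + 6 * s)) = (j \in snbr i).
Proof.
move=> i3; have addAC d : i + 6 * s + d = i + d + 6 * s by rewrite addnAC.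
have subAC d : d <= 3 -> i + 6 * s - d = i - d + 6 * s.
  by move=> d3; rewrite addnBAC // (leq_trans d3).
by rewrite !mem_snbr modnD6 modnD3 !addAC !subAC // !eqn_add2r.
Qed.

(** A step changes a position by at most 3, so under [3 * n <= i] every step starts at a position at
    least 3, where no subtraction in [snbr] truncates. *)
Lemma near_shift n i s j : 3 * n <= i -> j \in near n (i + 6 * s) ->
  exists2 k, j = k + 6 * s & k \in near n i.
Proof.
elim: n j => [|n IHn] j le_ni; first by rewrite inE => /eqP->; exists i; rewrite ?inE.
have /IHn{}IHn: 3 * n <= i by lia.
case/nearS=> [/IHn[k -> kN]|[_ /IHn[k -> kN]]].
  by exists k => //; apply/nearS; left.
have [kb _] := near_bounds kN.
move=> jk; have [jb _] := snbr_bounds jk.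
have ej : j = j - 6 * s + 6 * s by lia.
exists (j - 6 * s) => //; apply/nearS; right; exists k => //.
by move: jk; rewrite {1}ej mem_snbr_shift //; lia.
Qed.

Lemma near_unshift n i s k : 3 * n <= i -> k \in near n i ->
  k + 6 * s \in near n (i + 6 * s).
Proof.
elim: n k => [|n IHn] k le_ni; first by rewrite !inE => /eqP->.
have /IHn{}IHn: 3 * n <= i by lia.
case/nearS=> [/IHn|[l lN kl]]; first by move=> ?; apply/nearS; left.
have [lb _] := near_bounds lN.
apply/nearS; right; exists (l + 6 * s); first exact: IHn.
by rewrite mem_snbr_shift //; lia.
Qed.

(** * The strip as a covering of the H-graph *)

Definition henc n (x : hvertex n) : nat :=
  match x with hU i => 3 * i | hV i => 3 * i + 1 | hW i => 3 * i + 2 end.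

Lemma henc_lt n (x : hvertex n) : henc x < 3 * n.
Proof. by case: x => i /=; have := ltn_ord i; lia. Qed.

Lemma modn_add3 q a e : a < q -> e < 3 ->
  (3 * a + e + 3) %% (3 * q) = 3 * (a.+1 %% q) + e.
Proof.
move=> lt_aq lt_e3; have [lt_a1q|] := ltnP a.+1 q.
  by rewrite !modn_small; lia.
move=> le_qa; have -> : q = a.+1 by lia.
rewrite modnn (_ : _ + 3 = 3 * a.+1 + e); last lia.
by rewrite modnDl modn_small; lia.
Qed.

Lemma vv_arcE r (i j : 'I_(2 * r)) :
  harc (hV i) (hV j) = ~~ odd i && (j == i.+1 %% (2 * r) :> nat).
Proof.
have lti := ltn_ord i.
apply/existsP/andP => [[k /andP[/eqP ei /eqP ej]]|[ei /eqP ej]].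
  have ltk := ltn_ord k.
  by rewrite ei ej modn_small; [split=> //; lia | lia].
have ltk : i./2 < r by lia.
exists (Ordinal ltk) => /=; move: ej; rewrite modn_small; lia.
Qed.

(** Only the horizontal step can wrap around. Residue 4 modulo 6 marks the v-vertices of odd
    columns, whose horizontal edge goes left. *)
Lemma harcE r (x y : hvertex (2 * r)) :
  harc x y = (henc x %% 6 != 4) && (henc y == (henc x + 3) %% (6 * r)) ||
    (henc x %% 3 != 2) && (henc y == henc x + 1).
Proof.
have -> : 6 * r = 3 * (2 * r) by lia.
have add3 (i : 'I_(2 * r)) :
    (3 * i + 3) %% (3 * (2 * r)) = 3 * (i.+1 %% (2 * r)).
  by have := @modn_add3 (2 * r) i 0 (ltn_ord i) isT; rewrite !addn0.
case: x y => [i|i|i] [j|j|j]; rewrite ?vv_arcE [henc (_ i)]/= [henc (_ j)]/=;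
  rewrite ?add3 ?modn_add3 //=; rewrite -?val_eqE /=;
  move: (i.+1 %% _) => c; lia.
Qed.

Lemma henc_inj n : injective (@henc n).
Proof.
by case=> i [] j /= e; try congr (_ _); try apply: val_inj => /=; lia.
Qed.

Section Projection.
Variables (r : nat) (r_gt0 : 0 < r).

Fact columns_gt0 : 0 < 2 * r. Proof. by rewrite muln_gt0. Qed.

Definition proj (i : nat) : H_graph r :=
  let c := Ordinal (ltn_pmod (i %/ 3) columns_gt0) in
  match i %% 3 with 0 => hU c | 1 => hV c | _ => hW c end.

Lemma henc_proj i : henc (proj i) = i %% (6 * r).
Proof.
have lt3 : i %% 3 < 3 by rewrite ltn_pmod.
have ltc := ltn_pmod (i %/ 3) columns_gt0.
have -> : henc (proj i) = 3 * ((i %/ 3) %% (2 * r)) + i %% 3.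
  by rewrite /proj; case: (i %% 3) lt3 => [|[|[|]]] //= _; rewrite addn0.
have ei : i = (i %/ 3 %/ (2 * r)) * (6 * r) +
              (3 * ((i %/ 3) %% (2 * r)) + i %% 3).
  have := divn_eq i 3; have := divn_eq (i %/ 3) (2 * r).
  by move: (_ %/ (2 * r)) (_ %% (2 * r)) => a b; nia.
rewrite [in RHS]ei modnMDl; move: (_ %% (2 * r)) ltc => c ltc.
by rewrite [RHS]modn_small //; lia.
Qed.

Lemma proj_eq i j : (proj i == proj j) = (i == j %[mod 6 * r]).
Proof. by rewrite -!henc_proj (inj_eq (@henc_inj _)). Qed.

Lemma henc_modK i (x : H_graph r) : henc x = i %[mod 6 * r] -> proj i = x.
Proof.
move=> e; apply: henc_inj; rewrite henc_proj -e modn_small //.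
by have := henc_lt x; lia.
Qed.

Definition sarc i j : bool :=
  (i %% 6 != 4) && (j == i + 3) || (i %% 3 != 2) && (j == i + 1).

Lemma mem_snbrE i j : 3 <= i -> (j \in snbr i) = sarc i j || sarc j i.
Proof. by move=> ge3; rewrite mem_snbr /sarc; lia. Qed.

Lemma modn6r i : i %% (6 * r) %% 6 = i %% 6.
Proof. by rewrite modn_dvdm // dvdn_mulr. Qed.

Lemma modn3r i : i %% (6 * r) %% 3 = i %% 3.
Proof. by rewrite modn_dvdm // (_ : 6 = 3 * 2) // -mulnA dvdn_mulr. Qed.

Lemma modn_row_step i : i %% 3 != 2 -> (i + 1) %% (6 * r) = i %% (6 * r) + 1.
Proof.
move=> ne2; rewrite -modnDml modn_small //.
have lti : i %% (6 * r) < 6 * r by rewrite ltn_pmod //; lia.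
by move: ne2; rewrite -modn3r; move: (i %% _) lti => m; lia.
Qed.

Lemma harc_proj i j : sarc i j -> harc (proj i) (proj j).
Proof.
rewrite harcE !henc_proj modn6r modn3r /sarc.
case/orP=> /andP[ne /eqP->]; rewrite ne /= ?modnDml ?eqxx //.
by rewrite modn_row_step // eqxx orbT.
Qed.

Lemma harc_projl i (y : H_graph r) :
  harc (proj i) y -> exists2 j, sarc i j & proj j = y.
Proof.
rewrite harcE !henc_proj modn6r modn3r => /orP[] /andP[ne /eqP e].
  exists (i + 3); first by rewrite /sarc ne eqxx.
  by apply: henc_inj; rewrite henc_proj e modnDml.
exists (i + 1); first by rewrite /sarc ne eqxx orbT.
by apply: henc_inj; rewrite henc_proj e modn_row_step.
Qed.

Lemma harc_projr i (y : H_graph r) : 3 <= i ->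
  harc y (proj i) -> exists2 j, sarc j i & proj j = y.
Proof.
move=> ge3; rewrite harcE !henc_proj.
(* Residues modulo 6 and 3 survive reduction modulo [6 * r], so a step to the right can be undone in
   the strip. *)
suff back d : d <= i -> i = henc y + d %[mod 6 * r] ->
    [/\ (i - d) %% 6 = henc y %% 6, (i - d) %% 3 = henc y %% 3 &
        proj (i - d) = y].
  case/orP=> /andP[ne /eqP e].
    have [//|e6 _ ey] := back 3 ge3.
    by exists (i - 3); rewrite // /sarc e6 ne /=; lia.
  have [||_ e3 ey] := back 1; first lia.
    by rewrite -e modn_mod.
  by exists (i - 1); rewrite // /sarc e3 ne /=; lia.
move=> le_di e.
have {}e : i - d = henc y %[mod 6 * r].
  by apply/eqP; rewrite -(eqn_modDr d) subnK //; apply/eqP.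
split; last by apply: henc_modK.
  by rewrite -modn6r e modn6r.
by rewrite -modn3r e modn3r.
Qed.

Lemma adj_projP i (y : H_graph r) : 3 <= i ->
  reflect (exists2 j, j \in snbr i & proj j = y) (adj (proj i) y).
Proof.
move=> ge3; apply: (iffP orP) => [[]|[j]].
- by case/harc_projl=> j ij <-; exists j; rewrite // mem_snbrE // ij.
- by case/(harc_projr ge3)=> j ji <-; exists j; rewrite // mem_snbrE // ji orbT.
by rewrite mem_snbrE // => /orP[] /harc_proj a <-; [left | right].
Qed.

(** Walks lift through [proj] one step at a time by [adj_projP], so balls of the graph are images of
    balls of the strip. *)
Lemma near_projP n i (v : H_graph r) : 3 * n <= i ->
  (exists2 m, m <= n & walk_of_length (proj i) v m) <->
  (exists2 j, j \in near n i & proj j = v).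
Proof.
elim: n v => [|n IHn] v le_ni.
  split=> [[m]|[j]]; last by rewrite inE => /eqP-> <-; exists 0; rewrite ?walk0.
  rewrite leqn0 => /eqP->; rewrite walk0 => /eqP<-.
  by exists i; rewrite ?inE.
have /IHn{}IHn: 3 * n <= i by lia.
split=> [[[|m] le_mn]|[j /nearS[jN|[k kN kj]] <-]].
- move=> w0; case: (iffLR (IHn v)) => [|j jN ej]; first by exists 0.
  by exists j => //; apply/nearS; left.
- case/walkS=> w wm wv; case: (iffLR (IHn w)) => [|k kN ew]; first by exists m.
  have [kb _] := near_bounds kN.
  move: wv; rewrite -ew => /adj_projP[|j kj ej]; first by lia.
  by exists j => //; apply/nearS; right; exists k.
- case: (iffRL (IHn (proj j))) => [|m le_mn wm]; first by exists j.
  by exists m => //; apply: leqW.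
case: (iffRL (IHn (proj k))) => [|m le_mn wm]; first by exists k.
have [kb _] := near_bounds kN.
exists m.+1 => //; apply/walkS; exists (proj k) => //.
by apply/adj_projP; [lia | exists j].
Qed.

Lemma dist_gt_projP n i (v : H_graph r) : 3 * n <= i ->
  reflect (forall j, j \in near n i -> proj j <> v) (dist_gt (proj i) v n).
Proof.
move=> le_ni; apply: (iffP (dist_gtP _ _ _)) => [far j jN ej | far m le_mn].
  case: (iffRL (near_projP v le_ni)) => [|m /far/negP]; [by exists j | exact].
apply/negP=> wm; case: (iffLR (near_projP v le_ni)) => [|j /far]; last exact.
by exists m.
Qed.

End Projection.

(** * Exhaustive search on windows *)

(* The search colours the vertices 18, 19, ... in order: starting at 18 keeps all of
   [near c i] with c <= 5 away from 0.  Prefixes are stored last vertex first, and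
   offset d refers to the vertex d+1 places before i. *)
Definition back_offsets (i c : nat) : seq nat :=
  [seq i.-1 - j | j <- near c i & 18 <= j < i].

Definition constraints (k n m : nat) : seq (seq (nat * seq nat)) :=
  [seq [seq (c, back_offsets i c) | c <- iota 1 k] | i <- iota (18 + n) m].

(* [if] instead of [||], whose second argument vm_compute would always evaluate. *)
Fixpoint all_extensions (Q : pred (seq nat)) (T : seq (seq (nat * seq nat)))
    (cs : seq nat) : bool :=
  if T is row :: T' then
    all (fun p => if has (fun d => nth 0 cs d == p.1) p.2 then true
                  else all_extensions Q T' (p.1 :: cs)) row
  else Q cs.

Definition prefix_colours (a : nat -> nat) n := rev (map a (iota 18 n)).

Lemma prefix_coloursS a n :
  prefix_colours a n.+1 = a (18 + n) :: prefix_colours a n.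
Proof. by rewrite /prefix_colours -[n.+1]addn1 iotaD map_cat rev_cat. Qed.

Lemma nth_prefix_colours a n j : 18 <= j < 18 + n ->
  nth 0 (prefix_colours a n) ((18 + n).-1 - j) = a j.
Proof.
move=> jn; rewrite nth_rev ?size_map ?size_iota; last lia.
rewrite (nth_map 0) ?size_iota; last lia.
by rewrite nth_iota; [congr a | ]; lia.
Qed.

(** The colours of [a] single out a branch that no conflict cuts, and the search follows it down to
    the test of [Q]. *)
Lemma all_extensionsP (Q : pred (seq nat)) (a : nat -> nat) k n m :
    (forall i, i < 18 + (n + m) -> 1 <= a i <= k) ->
    (forall i j, 18 <= j < i -> i < 18 + (n + m) -> j \in near (a i) i ->
       a j <> a i) ->
  all_extensions Q (constraints k n m) (prefix_colours a n) ->
  Q (prefix_colours a (n + m)).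
Proof.
elim: m n => [|m IHm] n a_range a_pack /=; first by rewrite addn0.
move/allP/(_ (a (18 + n), back_offsets (18 + n) (a (18 + n)))).
rewrite -/(_ || _); case/(_ _)/orP => [|/hasP[d /mapP[j]]|].
- apply: (map_f (fun c => (c, back_offsets (18 + n) c))).
  by rewrite mem_iota; have := a_range (18 + n); lia.
- rewrite mem_filter => /andP[jn jN] -> /= /eqP.
  by rewrite nth_prefix_colours // => /(a_pack (18 + n) j) []; rewrite //; lia.
rewrite /= -prefix_coloursS -addnS -/(constraints k n.+1 m) -addSnnS => H.
by rewrite -addSnnS in a_range a_pack; apply: IHm a_range a_pack H.
Qed.

(** With [pred0] at the leaves, success means that no branch reaches full length. *)
Lemma no_4_colouring_window :
  all_extensions pred0 (constraints 4 0 12) [::].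
Proof. by vm_compute. Qed.

Definition alternating_5 (cs : seq nat) : bool :=
  (5 \in take 6 (rev cs)) != (5 \in take 6 (drop 6 (rev cs))).

(** The third column pair of the window prunes colourings of the first two that do not extend. *)
Lemma alternating_5_window :
  all_extensions alternating_5 (constraints 5 0 18) [::].
Proof. by vm_compute. Qed.

(** * Lower bounds *)

Section Colouring.
Variables (r k : nat) (r_gt0 : 0 < r) (pi : H_graph r -> nat).
Hypotheses (k_le5 : k <= 5) (pi_packing : packing_colouring k pi).

(** Translating by s column pairs lets every window start at 18. *)
Definition lift_colour s i := pi (proj r_gt0 (i + 6 * s)).

Lemma lift_colour_range s i : 1 <= lift_colour s i <= k.
Proof. by case/andP: pi_packing => /forallP/(_ (proj r_gt0 (i + 6 * s))). Qed.

Lemma lift_colour_packing s i j : 18 <= j < i -> i < 18 + 6 * r ->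
  j \in near (lift_colour s i) i -> lift_colour s j <> lift_colour s i.
Proof.
move=> /andP[ge18 lt_ji] lt_i jN e.
have /andP[_ le_k] := lift_colour_range s i.
(* The positions differ by less than [6 * r], so they stay distinct in the quotient. *)
have ji: proj r_gt0 (i + 6 * s) != proj r_gt0 (j + 6 * s).
  by rewrite proj_eq eqn_modDr eqn_mod_dvd 1?ltnW // gtnNdvd; lia.
case/andP: pi_packing => _ /forallP/(_ (proj r_gt0 (i + 6 * s))).
move/forallP/(_ (proj r_gt0 (j + 6 * s))).
rewrite ji -!/(lift_colour s _) e eqxx => /dist_gt_projP.
move/(_ _ (j + 6 * s)); apply=> //; first by lia.
by apply: near_unshift => //; lia.
Qed.

Lemma window_property (Q : pred (seq nat)) m s : m <= 6 * r ->
  all_extensions Q (constraints k 0 m) [::] ->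
  Q (prefix_colours (lift_colour s) m).
Proof.
move=> le_m; apply: (all_extensionsP (n := 0)) => [i _|i j ji lti].
  exact: lift_colour_range.
by apply: lift_colour_packing => //; lia.
Qed.

End Colouring.

Lemma no_packing_4_colouring r (pi : H_graph r -> nat) : 2 <= r ->
  ~~ packing_colouring 4 pi.
Proof.
move=> r_ge2; apply/negP=> pi_packing.
have r_gt0: 0 < r by lia.
have le12 : 12 <= 6 * r by lia.
by have := window_property (k := 4) r_gt0 isT pi_packing 0 le12 no_4_colouring_window.
Qed.

Lemma packing_5_colouring_even r (pi : H_graph r -> nat) : 3 <= r ->
  packing_colouring 5 pi -> ~~ odd r.
Proof.
move=> r_ge3 pi_packing; have r_gt0: 0 < r by lia.
(* Whether colour 5 occurs in the s-th column pair, counted from position 18. *)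
pose b s := 5 \in [seq lift_colour r_gt0 pi s i | i <- iota 18 6].
have bS s : b s.+1 = ~~ b s.
  have : alternating_5 (prefix_colours (lift_colour r_gt0 pi s) 18).
    (* Three column pairs fit into the cycle because [3 <= r]. *)
    apply: (window_property (k := 5) r_gt0 isT pi_packing s _ alternating_5_window); lia.
  rewrite /alternating_5 /prefix_colours revK -map_drop -!map_take.
  rewrite -[take 6 (iota _ _)]/(iota 18 6) -[take 6 (drop _ _)]/(iota 24 6).
  rewrite -/(b s) /b (iotaDl 6 18) -map_comp => alt.
  have /eq_map-> : lift_colour r_gt0 pi s.+1 =1
      lift_colour r_gt0 pi s \o addn 6.
    by move=> i; rewrite /lift_colour /= mulnS addnCA addnA.
  by case: (_ \in _) alt; case: (_ \in _).
have bE s : b s = b 0 (+) odd s.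
  by elim: s => [|s IHs]; rewrite ?addbF // bS IHs /= addbN.
(* After r pairs the cycle closes, so the alternation has even length. *)
have : b r = b 0.
  rewrite /b; congr (_ \in _); apply: eq_map => i; congr pi.
  by apply/eqP; rewrite proj_eq muln0 addn0 modnDr.
by rewrite bE; case: (b 0); case: (odd r).
Qed.

(** * Periodic colourings and their local verification *)

Lemma packing_colourableP (G : sgraph) k :
  packing_colourable G k <-> exists pi : G -> nat, packing_colouring k pi.
Proof.
split=> [/existsP[pi pi_packing]|[pi pi_packing]]; first by exists (fun u => nat_of_ord (pi u)).
apply/existsP; exists [ffun u => inord (pi u)].
have val_pi u : [ffun u => inord (pi u) : 'I_k.+1] u = pi u :> nat.
  rewrite ffunE inordK // ltnS.
  by case/andP: pi_packing => /forallP/(_ u)/andP[].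
case/andP: pi_packing => /forallP pi_range /forallP pi_far.
apply/andP; split; apply/forallP=> u; first by rewrite val_pi.
by apply/forallP=> v; rewrite !val_pi; apply: (forallP (pi_far u)).
Qed.

Lemma packing_colouring_leq (G : sgraph) k l (pi : G -> nat) :
  k <= l -> packing_colouring k pi -> packing_colouring l pi.
Proof.
move=> le_kl /andP[/forallP pi_range pi_far]; apply/andP; split=> //.
by apply/forallP=> u; case/andP: (pi_range u) => -> /leq_trans->.
Qed.

Lemma periodic_packing_colouring r k i0 (f : nat -> nat) : 0 < r -> 3 * k <= i0 ->
    (forall t, t < 6 * r -> 1 <= f t <= k) ->
    (forall i j, i0 <= i -> j \in near (f (i %% (6 * r))) i ->
       f (j %% (6 * r)) = f (i %% (6 * r)) -> j = i %[mod 6 * r]) ->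
  packing_colouring k (fun x : H_graph r => f (henc x)).
Proof.
move=> r_gt0 le_i0 f_range f_far.
have henc_lt6 (x : H_graph r) : henc x < 6 * r by have := henc_lt x; lia.
apply/andP; split; apply/forallP=> u; first exact: f_range.
apply/forallP=> v; apply/implyP=> /andP[/eqP uv /eqP e].
(* A representative of u beyond [i0], where [near] is the true ball. *)
pose i := i0 * (6 * r) + henc u.
have i_mod: i %% (6 * r) = henc u by rewrite modnMDl modn_small.
have i_ge: i0 <= i by rewrite /i; nia.
have {1}<- : proj r_gt0 i = u by apply: henc_modK; rewrite i_mod modn_small.
have /andP[_ fu_le] := f_range _ (henc_lt6 u).
apply/dist_gt_projP=> [|j jN ej]; first by lia.
have hv : henc v = j %% (6 * r) by rewrite -ej henc_proj.
have ji: j = i %[mod 6 * r].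
  by apply: f_far => //; rewrite i_mod // -hv.
by apply: uv; apply: henc_inj; rewrite hv ji i_mod.
Qed.

(** Colours above 5 are handled separately. For [q = 0] congruence is equality. *)
Definition near_check (g : nat -> nat) q i : bool :=
  (g i <= 5) ==>
  all (fun j => (g j == g i) ==> (j == i %[mod q])) (near (g i) i).

(** A ball of radius at most 5 lies within 15 positions of its centre, and translation by multiples
    of 6 preserves the strip; so a check at [a] settles [i] when the colours around them agree. *)
Lemma near_transfer (f g : nat -> nat) q i a j :
    15 <= a <= i -> a = i %[mod 6] ->
    (forall e, e <= 30 -> f (i - 15 + e) = g (a - 15 + e)) ->
    near_check g q a -> f i <= 5 -> j \in near (f i) i -> f j = f i ->
  j = i %[mod q].
Proof.
case/andP=> ge15 le_ai a_mod fg.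
have fgD s : i = a + s -> forall b, a <= b + 15 -> b <= a + 15 -> f (b + s) = g b.
  move=> ei b b1 b2; have le30: b + 15 - a <= 30 by lia.
  have ef: i - 15 + (b + 15 - a) = b + s by lia.
  have eg: a - 15 + (b + 15 - a) = b by lia.
  by rewrite -ef fg // eg.
have [s ei] : exists s, i = a + 6 * s by exists ((i - a) %/ 6); lia.
have {fgD}fgD := fgD _ ei; rewrite ei fgD; try lia.
move=> /implyP chk le5 jN ej; have {chk}/allP chk := chk le5.
have [|b eb bN] := near_shift _ jN; first by lia.
have [b1 b2] := near_bounds bN.
have /implyP := chk b bN; rewrite -[g b]fgD; try lia.
by rewrite -eb ej => /(_ (eqxx _)) /eqP; rewrite eb => e; apply/eqP; rewrite eqn_modDr e.
Qed.

(** * The explicit colourings *)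

Definition base_word : seq nat := [:: 1; 4; 1; 2; 1; 3; 1; 5; 1; 3; 1; 2].
Definition base_colour t := nth 0 base_word (t %% 12).

Definition patch_word : seq nat := [:: 6; 1; 2; 1; 4; 1; 2; 5; 7].
Definition patched_colour t :=
  if t < 9 then nth 0 patch_word t else base_colour t.

(* The colouring near the patch, which now sits at 36, for 6r = 6 modulo 12: to the left
   of the patch the periodic pattern is shifted by half a period. *)
Definition patched_line i :=
  if i < 36 then base_colour (i + 6) else patched_colour (i - 36).

Lemma base_colour_range t : 1 <= base_colour t <= 5.
Proof.
have : all (fun c => 1 <= c <= 5) base_word by [].
by move/(all_nthP 0); apply; rewrite ltn_pmod.
Qed.

Lemma base_colour_mod q t : 12 %| q -> base_colour (t %% q) = base_colour t.
Proof. by move=> q12; rewrite /base_colour modn_dvdm. Qed.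

Lemma eq_base_colour s t : s = t %[mod 12] -> base_colour s = base_colour t.
Proof. by rewrite /base_colour => ->. Qed.

Lemma patched_colour_base s t :
  9 <= s -> s = t %[mod 12] -> patched_colour s = base_colour t.
Proof.
by move=> s9 st; rewrite /patched_colour ltnNge s9; apply: eq_base_colour.
Qed.

Lemma base_window_check : all (near_check base_colour 0) (iota 24 12).
Proof. by vm_compute. Qed.

(** The patch occupies 36 to 44, so 21 to 59 are the centres whose window of radius 15 meets it. *)
Lemma patch_window_check : all (near_check patched_line 0) (iota 21 39).
Proof. by vm_compute. Qed.

(** For r = 3 and r = 5 a window can meet two copies of the patch, so the whole cycle is checked. *)
Lemma patched_small_check q : q \in [:: 18; 30] ->
  all (near_check (fun i => patched_colour (i %% q)) q) (iota q q).
Proof. by rewrite !inE => /orP[] /eqP->; vm_compute. Qed.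

Lemma even_packing_colouring r : 0 < r -> ~~ odd r ->
  packing_colouring 5 (fun x : H_graph r => base_colour (henc x)).
Proof.
move=> r_gt0 r_even.
have dvd12 : 12 %| 6 * r by lia.
apply: (@periodic_packing_colouring r 5 36) => // [t _|i j i_ge].
  exact: base_colour_range.
rewrite !base_colour_mod // => jN e.
suff /(congr1 (modn^~ (6 * r))) : j = i %[mod 0] by rewrite !modn0.
(* The position congruent to i modulo 12 in the checked period 24 to 35. *)
apply: (near_transfer (f := base_colour) (a := 24 + i %% 12)) jN e.
- by lia.
- by lia.
- by move=> n _; apply: eq_base_colour; lia.
- by apply: (allP base_window_check); rewrite mem_iota; lia.
by case/andP: (base_colour_range i).
Qed.

Lemma patched_colour_range t : 1 <= patched_colour t <= 7.
Proof.
rewrite /patched_colour; case: (ltnP _ 9) => [lt9|_].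
  have : all (fun c => 1 <= c <= 7) patch_word by [].
  by move/(all_nthP 0); apply.
by case/andP: (base_colour_range t) => -> /leq_trans->.
Qed.

(** Colours 6 and 7 occur once each, at 0 and 8. *)
Lemma patched_colour_gt5 t u :
  5 < patched_colour t -> patched_colour u = patched_colour t -> u = t.
Proof.
have patch_gt5 s : 5 < patched_colour s ->
    (s == 0) && (patched_colour s == 6) || (s == 8) && (patched_colour s == 7).
  rewrite /patched_colour; case: (ltnP _ 9) => [|_]; first by do 9?case: s => [|s] //.
  by case/andP: (base_colour_range s); lia.
move=> t5 e; have := patch_gt5 t t5; have := patch_gt5 u; rewrite e => /(_ t5).
lia.
Qed.

Lemma modn_window q i e : 15 <= q -> q <= i -> 
  (i - 15 + e) %% q =
    (if i %% q + e < 15 then q + (i %% q + e) - 15 else i %% q + e - 15) %% q.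
Proof.
move=> q15 le_qi; have := divn_eq i q; set t := i %% q => ei.
have d_gt0 : 0 < i %/ q by rewrite divn_gt0 //; lia.
rewrite {1}ei; case: ltnP => te.
  have -> : i %/ q * q + t - 15 + e = (i %/ q).-1 * q + (q + (t + e) - 15).
    by rewrite -{1}(prednK d_gt0) mulSn; lia.
  by rewrite modnMDl.
have -> : i %/ q * q + t - 15 + e = i %/ q * q + (t + e - 15).
  have : 15 <= i %/ q * q by nia.
  lia.
by rewrite modnMDl.
Qed.

(** The hypotheses on [q] give q = 6 modulo 12, whence the half-period shift left of the patch in
    [patched_line]. *)
Lemma patched_window q i : odd q./2 -> 6 %| q -> 42 <= q -> q <= i -> 60 <= i ->
  exists g a, [/\ 15 <= a <= i, a = i %[mod 6], near_check g 0 a &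
    forall e, e <= 30 -> patched_colour ((i - 15 + e) %% q) = g (a - 15 + e)].
Proof.
move=> q_odd q6 q_ge le_qi i_ge; have lt_tq : i %% q < q by rewrite ltn_pmod; lia.
have t_mod : i %% q = i %[mod 6] by rewrite modn_dvdm.
have window e : e <= 30 -> (i - 15 + e) %% q =
    if i %% q + e < 15 then q + (i %% q + e) - 15 else
    if i %% q + e < 15 + q then i %% q + e - 15 else i %% q + e - 15 - q.
  move=> e30; rewrite modn_window //; last by lia.
  move: (i %% q) lt_tq => t lt_tq.
  case: ltnP => e1; first by rewrite modn_small //; lia.
  case: ltnP => e2; first by rewrite modn_small //; lia.
  by rewrite -[in LHS](@subnK q (t + e - 15)) ?modnDr ?modn_small //; lia.
move: (i %% q) lt_tq t_mod window => t lt_tq t_mod window.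
(* The window misses the patch at 0 to 8 and its next copy at q exactly when [24 <= t < q - 15]. *)
have [t24|t24] := ltnP t 24; last have [tq|tq] := ltnP t (q - 15).
- exists patched_line, (t + 36); split; try lia.
    by apply: (allP patch_window_check); rewrite mem_iota; lia.
  move=> e e30; rewrite window // /patched_line.
  have [e1|e1] := ltnP (t + e) 15.
    rewrite ifT; last by lia.
    by apply: patched_colour_base; lia.
  rewrite ifT ?ifF; try lia.
  by congr patched_colour; lia.
- exists base_colour, (24 + t %% 12); split; try lia.
    by apply: (allP base_window_check); rewrite mem_iota; lia.
  move=> e e30; rewrite window // ifF ?ifT; try lia.
  by apply: patched_colour_base; lia.
exists patched_line, (t + 36 - q); split; try lia.
  by apply: (allP patch_window_check); rewrite mem_iota; lia.
move=> e e30; rewrite window // /patched_line.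
rewrite ifF; last by lia.
have [e1|e1] := ltnP (t + e) (15 + q).
  rewrite ifT; last by lia.
  by apply: patched_colour_base; lia.
rewrite ifF; last by lia.
by congr patched_colour; lia.
Qed.

Lemma odd_packing_colouring r : 3 <= r -> odd r ->
  packing_colouring 7 (fun x : H_graph r => patched_colour (henc x)).
Proof.
move=> r_ge3 r_odd; have r_gt0: 0 < r by lia.
(* The term [12 * r] covers the models taken in the second period for small r, and 60 exceeds those
   of [patched_window]. *)
apply: (@periodic_packing_colouring r 7 (12 * r + 60)) => // [|t _|i j i_ge jN e].
- by lia.
- exact: patched_colour_range.
have [c5|c5] := ltnP 5 (patched_colour (i %% (6 * r))).
  exact: patched_colour_gt5 e.
pose f k := patched_colour (k %% (6 * r)).
have [r7|r7] := leqP 7 r.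
  have [||||| g [a [a_range a_mod chk fg]]] := @patched_window (6 * r) i; try lia.
  suff /(congr1 (modn^~ (6 * r))) : j = i %[mod 0] by rewrite !modn0.
  exact: (near_transfer (f := f)) a_range a_mod fg chk c5 jN e.
have q_small : 6 * r \in [:: 18; 30] by rewrite !inE; lia.
have q_gt0 : 0 < 6 * r by lia.
apply: (near_transfer (f := f) (g := f) (a := 6 * r + i %% (6 * r))) jN e => //.
- have := leq_mod i (6 * r); have := ltn_pmod i q_gt0; lia.
- by rewrite -{1}[6 * r]mulnC modnMDl modn_dvdm ?dvdn_mulr.
- move=> k _; rewrite /f; congr patched_colour; apply/eqP.
  have -> : 6 * r + i %% (6 * r) - 15 + k = (6 * r - 15 + k) + i %% (6 * r) by lia.
  rewrite modnDmr; have -> : 6 * r - 15 + k + i = i - 15 + k + 6 * r by lia.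
  by rewrite modnDr.
by apply: (allP (patched_small_check q_small)); rewrite mem_iota ltn_add2l ltn_pmod ?leq_addr.
Qed.

Theorem theorem10 (r : nat) (hr : 2 <= r) :
  (~~ odd r -> packing_chromatic_number (H_graph r) = 5) /\
  (odd r -> 6 <= packing_chromatic_number (H_graph r) <= 7).
Proof.
rewrite /packing_chromatic_number.
case: ex_minnP => m /packing_colourableP[pi pi_packing] m_min.
have m_ge5: 5 <= m.
  rewrite leqNgt; apply/negP=> lt_m5.
  by have /negP[] := no_packing_4_colouring pi hr; apply: packing_colouring_leq pi_packing.
split=> r_parity.
  apply/eqP; rewrite eqn_leq m_ge5 andbT; apply/m_min/packing_colourableP.
  by eexists; apply: even_packing_colouring => //; lia.
have r_ge3: 3 <= r by lia.
apply/andP; split; last first.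
  by apply/m_min/packing_colourableP; eexists; apply: odd_packing_colouring.
rewrite ltn_neqAle m_ge5 andbT; apply/eqP=> m5; subst m.
by have /negP[] := packing_5_colouring_even r_ge3 pi_packing.
Qed.
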